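(* Let $K$ be a commutative field of characteristic $\neq 2$. For all integers $p,q\ge2$ and $r\ge0$ put \begin{align*} E_{p,q}(x)&=x^px^q-x^{p+1}-x^{q+1}+x^2,\\ F_{p,q}(x,y)&=x^p(x^qy)-x(xy)-x^py-x^{q+1}y+x^2y+xy,\\ F_{p,\{r\}}(x,y)&=x^p\bigl(x^{\{r\}}y\bigr)-x^py-x^{\{r+1\}}y+xy,\\ F_{\{r\},p}(x,y)&=x^{\{r\}}(x^py)-x^{\{r+1\}}y-x^{p+r}y+x^{r+1}y . \end{align*} Let $\mathscr I$ be the ideal generated by the family $(E_{p,q},F_{p,q},F_{p,\{r\}},F_{\{r\},p})_{p,q\ge2,\ r\ge0}$ and let $\pi:K(x,y)\to K(x,y)/\mathscr I$ be the canonical surjection. Let $\mathscr F=\{x^{n+1}y,\ x^{\{n\}}y : n\ge0\}$. Then for every $n\ge3$ and every monomial $w\in\mathfrak M(x,y)_{[n,1]}$ such that $w\notin\mathscr F$ one has $\pi(w)=P_w$, and for every $f\in\bigoplus_{n\ge3}K(x,y)_{[n,1]}$ the polynomial $f-\pi(f)$ is an evanescent train identity. Here, for $n\ge3$ and $w\in\mathfrak M(x,y)_{[n,1]}$ with $w\ne x^ny$ and $w\neq x^{\{n\}}y$, $P_w$ denotes the unique polynomial of $\mathbb Q\langle\mathscr F\rangle$ with $|P_w|_x<n$ such that $w-P_w$ is an evanescent train identity.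
   Context: $\mathfrak M(x,y)$ is the set of commutative nonassociative monomials in the letters $x,y$ (free commutative magma); $K(x,y)$ is the free commutative nonassociative $K$-algebra with basis $\mathfrak M(x,y)$. A monomial has type $[a,b]$ if $x$ occurs $a$ times and $y$ occurs $b$ times; $\mathfrak M(x,y)_{[a,b]}$ is the set of monomials of type $[a,b]$ and $K(x,y)_{[a,b]}$ its span; a polynomial is homogeneous if all its monomials have the same type; $|f|_x$ (resp. $|f|_y$) is the maximal number of occurrences of $x$ (resp. $y$) in the monomials of $f$. $K$ is assumed to satisfy $\operatorname{card}K^*>\max(|f|_x,|f|_y)$ for the polynomials $f$ considered. Principal powers: $x^1=x$, $x^{k+1}=x\,x^k$. For a polynomial $g$: $x^{\{0\}}g=g$, $x^{\{r\}}g=x\,(x^{\{r-1\}}g)$. $\mathbb Q\langle\mathscr F\rangle$ is the $\mathbb Q$-vector space spanned by $\mathscr F$. In the expressions $\pi(w)=P_w$ and $f-\pi(f)$, the class $\pi(f)$ is written as a linear combination of elements of $\mathscr F$, obtained by reducing $f$ modulo the generators of $\mathscr I$. For a letter $a$, $\partial_a:K(x,y)\to K[t]$ is the linear map with $\partial_a(a)=1$, $\partial_a(b)=0$ for a letter $b\ne a$, and $\partial_a(uv)=t(\partial_au+\partial_av)$ for monomials $u,v$. A polynomial $f$ is an evanescent identity if $f\ne0$, $\partial_xf=\partial_yf=0$ and $f(1,1)=0$, where $f(1,1)$ is the sum of the coefficients of $f$. A train polynomial of degree $(n,1)$ is a non-homogeneous polynomial $f=g-\sum_{i=1}^rh_i$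 with $f(1,1)=0$, $g$ homogeneous of type $[n,1]$, and each $h_i$ homogeneous of type $[\delta_i,1]$, where $0\le\delta_1<\dots<\delta_r<n$. An evanescent train identity is a train polynomial that is an evanescent identity.
   Formalization: For w = x^{r}(x^p y) with r≥1, p≥2, no P_w with |P_w|_x<n exists, so |P_w|_x≤n is allowed there; f−π(f) is proved an evanescent identity only for f outside K<F> (otherwise it is 0), and a train identity only when it is non-homogeneous. *)

(* Defs.v *)
From HB Require Import structures.
From mathcomp Require Import all_boot all_algebra.
From mathcomp Require Import finmap.
From mathcomp.multinomials Require Import monalg.
From mathcomp Require Import boolp classical_sets.

Set Implicit Arguments.
Unset Strict Implicit.
Unset Printing Implicit Defensive.

Import GRing.Theory.
Local Open Scope ring_scope.
Local Open Scope quotient_scope.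
Local Open Scope classical_set_scope.

Definition letter := bool.
Definition lx : letter := true.
Definition ly : letter := false.

Inductive tree := Leaf of letter | Node of tree & tree.

Fixpoint tree_encode (t : tree) : GenTree.tree letter :=
  match t with
  | Leaf a => GenTree.Leaf a
  | Node u v => GenTree.Node 0 [:: tree_encode u; tree_encode v]
  end.

Fixpoint tree_decode (t : GenTree.tree letter) : option tree :=
  match t with
  | GenTree.Leaf a => Some (Leaf a)
  | GenTree.Node 0 [:: u; v] =>
      match tree_decode u, tree_decode v with
      | Some u', Some v' => Some (Node u' v')
      | _, _ => None
      end
  | _ => None
  end.

Lemma tree_encodeK : pcancel tree_encode tree_decode.
Proof. by elim=> //= u -> v ->. Qed.

HB.instance Definition _ := Choice.copy tree (pcan_type tree_encodeK).

(* Equality up to swapping the two factors at any nodes: the congruence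
   generated by uv ~ vu. *)
Fixpoint ceq (s t : tree) : bool :=
  match s, t with
  | Leaf a, Leaf b => a == b
  | Node u v, Node u' v' => (ceq u u' && ceq v v') || (ceq u v' && ceq v u')
  | _, _ => false
  end.

Lemma ceq_refl : reflexive ceq.
Proof. by elim=> [a|u IHu v IHv] /=; rewrite ?eqxx ?IHu ?IHv. Qed.

Lemma ceq_sym : symmetric ceq.
Proof.
elim=> [a|u IHu v IHv] [b|u' v'] //=.
rewrite !IHu !IHv; congr (_ || _); exact: andbC.
Qed.

Lemma ceq_trans : transitive ceq.
Proof.
move=> t s; elim: s t => [a|u IHu v IHv] [b|u1 v1] [c|u2 v2] //=.
  by move=> /eqP ->.
by case/orP=> /andP[h1 h2] /orP[] /andP[h3 h4];
  rewrite ?(IHu _ _ h1 h3) ?(IHv _ _ h2 h4) ?(IHu _ _ h1 h4) ?(IHv _ _ h2 h3)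
          ?orbT.
Qed.

Canonical ceq_equiv := EquivRel ceq ceq_refl ceq_sym ceq_trans.

(* The free commutative magma M(x,y). *)
Definition mon := {eq_quot ceq}.

Definition mlet (a : letter) : mon := \pi_mon (Leaf a).
Definition mmult (u v : mon) : mon := \pi_mon (Node (repr u) (repr v)).

Declare Scope mon_scope.
Delimit Scope mon_scope with mon.
Notation "u ** v" := (mmult u v) (at level 40, left associativity) : mon_scope.
Notation mX := (mlet lx).
Notation mY := (mlet ly).

Lemma mmult_pi (s t : tree) :
  mmult (\pi_mon s) (\pi_mon t) = \pi_mon (Node s t).
Proof.
apply/eqmodP => /=; apply/orP; left; apply/andP.
by split; apply/eqmodP; rewrite reprK.
Qed.

Lemma mmultC : commutative mmult.
Proof.
by move=> u v; apply/eqmodP; rewrite /= !ceq_refl orbT.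
Qed.

Fixpoint tocc (a : letter) (t : tree) : nat :=
  match t with
  | Leaf b => (a == b)
  | Node u v => tocc a u + tocc a v
  end.

Definition occ (a : letter) (u : mon) : nat := tocc a (repr u).

(* u is of type [a,b] iff mtype u = (a,b). *)
Definition mtype (u : mon) : nat * nat := (occ lx u, occ ly u).

(* x^k for k >= 1; the value at k = 0 is junk and never used. *)
Definition xpow (k : nat) : mon := iter k.-1 (mmult mX) mX.

(* x^{r} w, for a monomial w. *)
Definition xact (r : nat) (w : mon) : mon := iter r (mmult mX) w.

Definition scrF : set mon :=
  [set w | exists n : nat, w = (xpow n.+1 ** mY)%mon \/ w = xact n mY].

Section Algebra.
Variable K : fieldType.

Definition alg := {malg K[mon]}.

Definition amul (f g : alg) : alg :=
  \sum_(u <- msupp f) \sum_(v <- msupp g) << f@_u * g@_v *g (u ** v)%mon >>.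

(* The ideal of the nonunital algebra K(x,y) generated by G. *)
Inductive ideal_gen (G : set alg) : set alg :=
  | Ideal_gen f of G f : ideal_gen G f
  | Ideal_0 : ideal_gen G 0
  | Ideal_add f g of ideal_gen G f & ideal_gen G g : ideal_gen G (f + g)
  | Ideal_scale (c : K) f of ideal_gen G f : ideal_gen G (c *: f)
  | Ideal_mull g f of ideal_gen G f : ideal_gen G (amul g f)
  | Ideal_mulr g f of ideal_gen G f : ideal_gen G (amul f g).

Definition E_ (p q : nat) : alg :=
  << (xpow p ** xpow q)%mon >> - << xpow p.+1 >> - << xpow q.+1 >>
  + << xpow 2 >>.

Definition F_ (p q : nat) : alg :=
  << (xpow p ** (xpow q ** mY))%mon >> - << (mX ** (mX ** mY))%mon >>
  - << (xpow p ** mY)%mon >> - << (xpow q.+1 ** mY)%mon >>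
  + << (xpow 2 ** mY)%mon >> + << (mX ** mY)%mon >>.

(* F_{p,{r}} *)
Definition Fpr (p r : nat) : alg :=
  << (xpow p ** xact r mY)%mon >> - << (xpow p ** mY)%mon >>
  - << xact r.+1 mY >> + << (mX ** mY)%mon >>.

(* F_{{r},p} *)
Definition Frp (r p : nat) : alg :=
  << xact r (xpow p ** mY)%mon >> - << xact r.+1 mY >>
  - << (xpow (p + r) ** mY)%mon >> + << (xpow r.+1 ** mY)%mon >>.

Definition scrI_gens : set alg :=
  [set f | exists p q r : nat, [/\ (2 <= p)%N, (2 <= q)%N &
     [\/ f = E_ p q, f = F_ p q, f = Fpr p r | f = Frp r p]]].

Definition scrI : set alg := ideal_gen scrI_gens.

(* The canonical surjection onto K(x,y)/I, whose elements are the cosets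
   f + I seen as sets of polynomials. *)
Definition pi_I (f : alg) : set alg := [set g | scrI (g - f)].

Definition deg_ (a : letter) (f : alg) : nat :=
  \max_(u <- msupp f) occ a u.

Definition homog_type (ab : nat * nat) (f : alg) : Prop :=
  forall u, u \in msupp f -> mtype u = ab.

Definition homogeneous (f : alg) : Prop := exists ab, homog_type ab f.

(* f lies in the direct sum of the K(x,y)_[n,1] over n >= 3. *)
Definition in_sum3 (f : alg) : Prop :=
  forall u, u \in msupp f -> exists2 n, (3 <= n)%N & mtype u = (n, 1%N).

(* K<F> *)
Definition spanF (f : alg) : Prop := forall u, u \in msupp f -> scrF u.

(* The image of Q in K: all of Q in characteristic 0, the prime field (where
   rationals with denominator prime to p are reduced mod p) otherwise. *)
Definition rational (c : K) : Prop :=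
  exists m d : int, d%:~R != 0 :> K /\ c = m%:~R / d%:~R.

(* Q<F>, seen in K(x,y). *)
Definition spanF_rat (f : alg) : Prop :=
  spanF f /\ forall u, rational f@_u.

Fixpoint tder (a : letter) (t : tree) : {poly K} :=
  match t with
  | Leaf b => (a == b)%:R
  | Node u v => 'X * (tder a u + tder a v)
  end.

(* The linear map partial_a : K(x,y) -> K[t]. *)
Definition der (a : letter) (f : alg) : {poly K} :=
  \sum_(u <- msupp f) f@_u *: tder a (repr u).

(* f(1,1) *)
Definition eval11 (f : alg) : K := \sum_(u <- msupp f) f@_u.

Definition evanescent (f : alg) : Prop :=
  [/\ f <> 0, der lx f = 0, der ly f = 0 & eval11 f = 0].

Definition train_poly (n : nat) (f : alg) : Prop :=
  [/\ ~ homogeneous f, eval11 f = 0 &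
   exists (g : alg) (r : nat) (delta : 'I_r -> nat) (h : 'I_r -> alg),
   [/\ f = g - \sum_(i < r) h i,
       g <> 0 /\ homog_type (n, 1%N) g,
       forall i, homog_type (delta i, 1%N) (h i),
       forall i j : 'I_r, (i < j)%N -> (delta i < delta j)%N &
       forall i, (delta i < n)%N]].

Definition evanescent_train (f : alg) : Prop :=
  evanescent f /\ exists n, train_poly n f.

(* The monomials x^{r}(x^p y), r >= 1, p >= 2: the generator F_{{r},p} rewrites
   them with the term x^{p+r} y, which has as many x as the monomial itself. *)
Definition exceptional (w : mon) : Prop :=
  exists r p : nat,
    [/\ (1 <= r)%N, (2 <= p)%N & w = xact r (xpow p ** mY)%mon].

(* P is a candidate for P_w, where w has type [n,1].  No P of degree in x less
   than n exists when w is exceptional, so degree n is allowed there (only). *)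
Definition is_P (n : nat) (w : mon) (P : alg) : Prop :=
  [/\ spanF_rat P,
      (deg_ lx P <= n)%N,
      ~ exceptional w -> (deg_ lx P < n)%N &
      evanescent_train (<< w >> - P)].

(* R is the class of f modulo I, written as a linear combination of
   elements of F. *)
Definition is_pi (f R : alg) : Prop := spanF R /\ pi_I f = pi_I R.

(* card K^* > m *)
Definition card_units_gt (m : nat) : Prop :=
  exists s : seq K, [/\ uniq s, 0 \notin s & (m < size s)%N].

End Algebra.

(* Main.v *)
From HB Require Import structures.
Require Import Defs.
From mathcomp Require Import all_boot all_algebra finmap.
From mathcomp.multinomials Require Import monalg.
From mathcomp Require Import boolp classical_sets ring zify.

Import GRing.Theory.
Local Open Scope ring_scope.
Local Open Scope quotient_scope.

(** The generators of the ideal are killed by [der lx], [der ly] and [eval11],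
and [der a (f g) = t (g(1,1) der a f + f(1,1) der a g)], so these three maps
vanish on the whole ideal.  Read as rewriting rules, the generators reduce
every monomial of type [n,0] to principal powers and every monomial of type
[n,1] to an integral combination [R] of elements of [scrF].  In characteristic
other than 2, [der lx] and [der ly] are jointly injective on the span of
[scrF]: the leading terms are [2 t^k] and [0] for [x^k y], [t^k] and [t^k] for
[x^{k} y].  Hence [R] is unique, and its degree is bounded by the height of
the monomial, which reaches its number of [x]'s only for the caterpillars
[x^{r} (x^p y)]. *)

(** * Induction on monomials and occurrence counts *)

Lemma mon_ind (Q : mon -> Prop) :
    (forall a, Q (mlet a)) ->
    (forall u v, Q u -> Q v -> Q (u ** v)%mon) ->
  forall u, Q u.
Proof.
move=> Qlet Qmul u; rewrite -[u]reprK; elim: (repr u) => [a|s IHs t IHt].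
  exact: Qlet.
by rewrite -mmult_pi; apply: Qmul.
Qed.

Lemma tocc_ceq a s t : ceq s t -> tocc a s = tocc a t.
Proof.
elim: s t => [b|s1 IH1 s2 IH2] [c|t1 t2] //=; first by move/eqP->.
by case/orP=> /andP[/IH1-> /IH2->] //; rewrite addnC.
Qed.

Lemma tocc_pi a t : occ a (\pi_mon t) = tocc a t.
Proof. by apply: tocc_ceq; apply/eqmodP; rewrite reprK. Qed.

Lemma occ_let a b : occ a (mlet b) = (a == b).
Proof. exact: tocc_pi. Qed.

Lemma occM a u v : occ a (u ** v)%mon = (occ a u + occ a v)%N.
Proof. exact: tocc_pi. Qed.

Lemma occ_xact a r u : occ a (xact r u) = (r * (a == lx) + occ a u)%N.
Proof. by elim: r => //= r IH; rewrite occM occ_let IH mulSn addnA. Qed.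

Lemma xpowS p : xpow p.+2 = (mX ** xpow p.+1)%mon.
Proof. by []. Qed.

Lemma xpow_xact p : xpow p.+1 = xact p mX.
Proof. by []. Qed.

Lemma occ_xpow a p : occ a (xpow p.+1) = (p.+1 * (a == lx))%N.
Proof. by rewrite xpow_xact occ_xact occ_let mulSn addnC. Qed.

(** No monomial is empty: each multiplication thus adds at least one letter, which is what makes
    depth bounded by letter count. *)
Lemma occ_gt0 u : (0 < occ lx u + occ ly u)%N.
Proof.
elim/mon_ind: u => [[]|u v IHu IHv]; rewrite ?occ_let ?occM //.
by rewrite addnACA addn_gt0 IHu.
Qed.

Lemma occ_scrF u : scrF u -> occ ly u = 1%N.
Proof.
by case=> n [] ->; rewrite ?occM ?occ_xpow ?occ_xact occ_let /= muln0.
Qed.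

(** * Derivatives of monomials and their leading coefficients *)

Section MonomialDerivative.
Variable K : fieldType.

(** The coefficient of t^k is the number, taken in [K], of leaves [a] at depth k in the tree of
    [u]. *)
Definition mder (a : letter) (u : mon) : {poly K} := tder K a (repr u).

Lemma tder_ceq a s t : ceq s t -> tder K a s = tder K a t.
Proof.
elim: s t => [b|s1 IH1 s2 IH2] [c|t1 t2] //=; first by move/eqP->.
by case/orP=> /andP[/IH1-> /IH2->] //; rewrite addrC.
Qed.

Lemma mder_pi a t : mder a (\pi_mon t) = tder K a t.
Proof. by apply: tder_ceq; apply/eqmodP; rewrite reprK. Qed.

Lemma mder_let a b : mder a (mlet b) = (a == b)%:R.
Proof. exact: mder_pi. Qed.

Lemma mderM a u v : mder a (u ** v)%mon = 'X * (mder a u + mder a v).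
Proof. exact: mder_pi. Qed.

Lemma mder_occ0 a u : occ a u = 0%N -> mder a u = 0.
Proof.
elim/mon_ind: u => [b|u v IHu IHv].
  by rewrite occ_let mder_let; case: eqP.
rewrite occM mderM => /eqP; rewrite addn_eq0 => /andP[/eqP/IHu-> /eqP/IHv->].
by rewrite addr0 mulr0.
Qed.

Lemma mdery_xact r u : mder ly (xact r u) = 'X^r * mder ly u.
Proof.
elim: r => [|r IH]; first by rewrite expr0 mul1r.
by rewrite /= mderM mder_let add0r IH exprS mulrA.
Qed.

Lemma mdery_xpowY p : mder ly (xpow p.+1 ** mY)%mon = 'X.
Proof.
by rewrite mderM mder_occ0 ?occ_xpow ?muln0 // mder_let add0r mulr1.
Qed.

Lemma mdery_xactY r : mder ly (xact r mY) = 'X^r.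
Proof. by rewrite mdery_xact mder_let mulr1. Qed.

Lemma size_XM (p : {poly K}) : (size ('X * p)%R <= (size p).+1)%N.
Proof.
by apply: leq_trans (size_polyMleq _ _) _; rewrite size_polyX.
Qed.

Lemma size_mderM a u v :
  (size (mder a (u ** v)%mon)
    <= (maxn (size (mder a u)) (size (mder a v))).+1)%N.
Proof.
by rewrite mderM; apply: leq_trans (size_XM _) _; rewrite ltnS size_polyD.
Qed.

(** A tree with m leaves has depth at most m - 1, and the size of a polynomial is its degree plus
    one. *)
Lemma size_mder a u : (size (mder a u) <= occ lx u + occ ly u)%N.
Proof.
elim/mon_ind: u => [b|u v IHu IHv].
  by rewrite mder_let !occ_let; case: a b => [] []; rewrite ?size_poly0 ?size_poly1.
apply: leq_trans (size_mderM _ _ _) _; rewrite !occM addnACA.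
rewrite -maxnSS geq_max; apply/andP; split.
  by rewrite -addn1; apply: leq_add (occ_gt0 _).
by rewrite -add1n; apply: leq_add (occ_gt0 _) _.
Qed.

Lemma coef_mder_ge a u k :
  (occ lx u + occ ly u <= k)%N -> (mder a u)`_k = 0.
Proof. by move=> le_k; rewrite nth_default // (leq_trans (size_mder _ _)). Qed.

(** The two deepest leaves of a principal power are both [x]; for x^{k} y, one of the two is [y], so
    the count drops to 1. *)
Lemma mderx_xpow_top p : (mder lx (xpow p.+2))`_p.+1 = 2%:R.
Proof.
elim: p => [|p IH]; rewrite xpowS mderM coefXM coefD mder_let /= coef1.
  by rewrite -natrD.
by rewrite IH add0r.
Qed.

Lemma mderx_xact_top r : (mder lx (xact r.+1 mY))`_r.+1 = 1.
Proof.
elim: r => [|r IH]; rewrite [xact _ _]/= mderM coefXM coefD mder_let /= coef1.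
  by rewrite mder_let coef0 addr0.
by rewrite IH add0r.
Qed.

(** The leaf [y] sits at depth 1 on one side and k on the other. At k = 1 the families do meet, in x
    y. *)
Lemma xpowY_neq_xactY p k : (1 < k)%N -> (xpow p.+1 ** mY)%mon != xact k mY.
Proof.
move=> lt1k; apply/eqP=> /(congr1 (mder ly)).
rewrite mdery_xpowY mdery_xactY => /(congr1 (fun p : {poly K} => size p)).
by rewrite size_polyX size_polyXn => -[] e; rewrite -e in lt1k.
Qed.

Lemma coef_mdery_xact j k :
  (mder ly (xact j mY))`_k = (xact j mY == xact k mY)%:R.
Proof.
rewrite mdery_xactY coefXn; have [->|ne] := eqVneq k j; first by rewrite eqxx.
case: eqP => // /(congr1 (occ lx)); rewrite !occ_xact occ_let !muln1 !addn0.
by move=> e; rewrite e eqxx in ne.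
Qed.

Lemma coef_mdery_scrF u k : scrF u -> (1 < k)%N ->
  (mder ly u)`_k = (u == xact k mY)%:R.
Proof.
move=> [j [->|->]] lt1k; last exact: coef_mdery_xact.
rewrite mdery_xpowY (negPf (xpowY_neq_xactY _ _ lt1k)) // coefX.
by case: k lt1k => [|[]].
Qed.

(** An element of [scrF] with fewer than k letters [x] has depth below k, so only the two elements
    with exactly k of them reach t^k. *)
Lemma coef_mderx_scrF u k : scrF u -> (1 < k)%N -> (occ lx u <= k)%N ->
  (mder lx u)`_k = (u == (xpow k ** mY)%mon)%:R *+ 2 + (u == xact k mY)%:R.
Proof.
move=> Fu lt1k; rewrite leq_eqVlt => /orP[/eqP eqk|ltk]; last first.
  rewrite coef_mder_ge ?(occ_scrF _ Fu) ?addn1 //.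
  case: eqP => [e|_]; last case: eqP => [e|_]; last by rewrite mul0rn addr0.
    move: ltk; rewrite e; case: k lt1k {e} => // k _.
    by rewrite occM occ_xpow occ_let muln1 addn0 ltnn.
  by move: ltk; rewrite e occ_xact occ_let muln1 addn0 ltnn.
case: Fu eqk lt1k => n [] ->.
  rewrite occM occ_xpow occ_let muln1 addn0 => <- lt1.
  rewrite eqxx (negPf (xpowY_neq_xactY _ _ lt1)) addr0.
  case: n lt1 => // n _; rewrite mderM mder_let addr0 coefXM /=.
  exact: mderx_xpow_top.
rewrite occ_xact occ_let muln1 addn0 => <-; case: n => // n lt1.
rewrite eqxx eq_sym (negPf (xpowY_neq_xactY _ _ lt1)) mul0rn add0r.
exact: mderx_xact_top.
Qed.

End MonomialDerivative.

(** * Linear extension of a map given on the basis *)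

Section LinearExtension.
Variables (T : choiceType) (K : fieldType).

Lemma scale_malgU (c d : K) (u : T) :
  c *: << d *g u >> = << c * d *g u >> :> {malg K[T]}.
Proof. by apply/malgP=> v; rewrite mcoeffZ !mcoeffU mulrnAr. Qed.

Variable V : lmodType K.
Implicit Types (phi : T -> V) (f g : {malg K[T]}).

(** Common form of [der], [eval11] and both partial maps of [amul], so that linearity is proved once
    for all of them. *)
Definition linext phi f : V := \sum_(u <- msupp f) f@_u *: phi u.

Lemma linextEw phi (d : {fset T}) f : (msupp f `<=` d)%fset ->
  linext phi f = \sum_(u <- d) f@_u *: phi u.
Proof.
move=> le_d; apply: big_fset_incl => // u _ /mcoeff_outdom ->.
by rewrite scale0r.
Qed.

Lemma linext_is_linear phi : linear (linext phi).
Proof.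
move=> c f g; set d := (msupp f `|` msupp g)%fset.
rewrite (@linextEw phi d f) ?fsubsetUl // (@linextEw phi d g) ?fsubsetUr //.
rewrite (@linextEw phi d); last first.
  apply: fsubset_trans (msuppD_le _ _) _.
  exact: fsetUSS (msuppZ_le _ _) (fsubset_refl _).
rewrite scaler_sumr -big_split /=; apply: eq_bigr => u _.
by rewrite mcoeffD mcoeffZ scalerDl scalerA.
Qed.

HB.instance Definition _ phi :=
  GRing.isLinear.Build K {malg K[T]} V *:%R (linext phi) (linext_is_linear phi).

Lemma linextU phi c u : linext phi << c *g u >> = c *: phi u.
Proof.
rewrite (@linextEw phi [fset u]%fset) ?msuppU_le // big_seq_fset1.
by rewrite mcoeffUU.
Qed.

Lemma linext_sum4 phi (u1 u2 u3 u4 : T) :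
  linext phi (<< u1 >> - << u2 >> - << u3 >> + << u4 >>)
    = phi u1 - phi u2 - phi u3 + phi u4.
Proof. by rewrite linearD !linearB /= !linextU !scale1r. Qed.

Lemma linext_sum6 phi (u1 u2 u3 u4 u5 u6 : T) :
  linext phi (<< u1 >> - << u2 >> - << u3 >> - << u4 >> + << u5 >> + << u6 >>)
    = phi u1 - phi u2 - phi u3 - phi u4 + phi u5 + phi u6.
Proof. by rewrite 2!linearD !linearB /= !linextU !scale1r. Qed.

End LinearExtension.

(** * The derivatives and the evaluation vanish on the ideal *)

Section IdealKernel.
Variable K : fieldType.
Implicit Types (f g h : alg K) (a : letter).

Lemma derE a f : der a f = linext mon K _ (mder K a) f.
Proof. by []. Qed.

Lemma eval11E f : eval11 f = linext mon K K^o (fun=> 1) f.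
Proof. by apply: eq_bigr => u _; rewrite /GRing.scale /= mulr1. Qed.

Lemma der_mon a u : der a << u >> = mder K a u.
Proof. by rewrite derE linextU scale1r. Qed.

Lemma eval11_mon u : eval11 (<< u >> : alg K) = 1.
Proof. by rewrite eval11E linextU scale1r. Qed.

Lemma amulE f g :
  amul f g = linext mon K (alg K) (fun u =>
    linext mon K (alg K) (fun v => << (u ** v)%mon >>) g) f.
Proof.
apply: eq_bigr => u _; rewrite scaler_sumr; apply: eq_bigr => v _.
by rewrite !scale_malgU mulr1.
Qed.

Lemma amulEr f g :
  amul f g = linext mon K (alg K) (fun v =>
    linext mon K (alg K) (fun u => << (u ** v)%mon >>) f) g.
Proof.
rewrite /amul exchange_big; apply: eq_bigr => v _ /=.
rewrite scaler_sumr; apply: eq_bigr => u _.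
by rewrite !scale_malgU mulr1 mulrC.
Qed.

Lemma amul0l g : amul 0 g = 0. Proof. by rewrite amulE linear0. Qed.
Lemma amul0r f : amul f 0 = 0. Proof. by rewrite amulEr linear0. Qed.
Lemma amulNl f g : amul (- f) g = - amul f g. Proof. by rewrite !amulE linearN. Qed.
Lemma amulNr f g : amul f (- g) = - amul f g. Proof. by rewrite !amulEr linearN. Qed.
Lemma amulDl f g h : amul (f + g) h = amul f h + amul g h.
Proof. by rewrite !amulE linearD. Qed.
Lemma amulDr f g h : amul h (f + g) = amul h f + amul h g.
Proof. by rewrite !amulEr linearD. Qed.
Lemma amulUU u v : amul << u >> << v >> = << (u ** v)%mon >> :> alg K.
Proof. by rewrite amulE !linextU !scale1r. Qed.

Lemma eval11_amul f g : eval11 (amul f g) = eval11 f * eval11 g.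
Proof.
have eval_monl u :
    eval11 (linext mon K (alg K) (fun v => << (u ** v)%mon >>) g) = eval11 g.
  rewrite {1}/linext eval11E linear_sum /=; apply: eq_bigr => v _.
  by rewrite linearZ /= linextU scale1r /GRing.scale /= mulr1.
rewrite amulE {1}/linext eval11E linear_sum mulr_suml; apply: eq_bigr => u _.
by rewrite linearZ /= -eval11E eval_monl.
Qed.

(** On monomials this is the defining rule of the derivative; summing over one factor turns the
    other factor's coefficients into its value at (1,1). *)
Lemma der_amul a f g :
  der a (amul f g) = 'X * (eval11 g *: der a f + eval11 f *: der a g).
Proof.
have der_monl u : der a (linext mon K (alg K) (fun v => << (u ** v)%mon >>) g)
    = 'X * (eval11 g *: mder K a u + der a g).
  rewrite {1}/linext derE linear_sum /= mulrDr mulr_sumr scaler_suml.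
  rewrite mulr_sumr -big_split /=; apply: eq_bigr => v _.
  by rewrite linearZ /= linextU scale1r mderM -mulrDr -scalerDr scalerAr.
rewrite amulE {1}/linext derE linear_sum /= mulrDr scaler_sumr scaler_suml.
rewrite !mulr_sumr -big_split /=; apply: eq_bigr => u _.
rewrite linearZ /= -derE der_monl -mulrDr scalerAr scalerDr !scalerA.
by rewrite [_ * eval11 g]mulrC.
Qed.

(** Evanescence without the condition that [f] is nonzero, hence stable under the ideal
    operations. *)
Definition annihilated f := [/\ der lx f = 0, der ly f = 0 & eval11 f = 0].

Lemma derD a f g : der a (f + g) = der a f + der a g.
Proof. by rewrite !derE linearD. Qed.

Lemma derB a f g : der a (f - g) = der a f - der a g.
Proof. by rewrite !derE linearB. Qed.

Lemma derZ a c f : der a (c *: f) = c *: der a f.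
Proof. by rewrite !derE linearZ. Qed.

Lemma eval11D f g : eval11 (f + g) = eval11 f + eval11 g.
Proof. by rewrite !eval11E linearD. Qed.

Lemma eval11Z c f : eval11 (c *: f) = c * eval11 f.
Proof. by rewrite !eval11E linearZ. Qed.

Lemma annihilated0 : annihilated 0.
Proof. by split; rewrite ?derE ?eval11E linear0. Qed.

(** The spine letters [x] contribute as in x^{r} y, whose [y] counts for nothing, and the leaves of
    [u] move r levels down. *)
Lemma mderx_xact r u :
  mder K lx (xact r u) = mder K lx (xact r mY) + 'X^r * mder K lx u.
Proof.
elim: r => [|r IH]; first by rewrite /= mder_let add0r mul1r.
rewrite /= mderM IH mderM exprS; ring.
Qed.

Lemma gens_annihilated f : scrI_gens f -> annihilated f.
Proof.
have dpow r : mder K ly (xpow r.+1) = 0 by rewrite mder_occ0 // occ_xpow muln0.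
have dxpow r : mder K lx (xpow r.+2) = 'X * (1 + mder K lx (xpow r.+1)).
  by rewrite xpowS mderM mder_let.
have dxpow1 : mder K lx (xpow 1) = 1 by rewrite mder_let.
have dxact r : mder K lx (xact r.+1 mY) = 'X * (1 + mder K lx (xact r mY)).
  by rewrite mderM mder_let.
(* Second recursion for the same polynomial: here the innermost [x] is removed, in [dxact] the
   outermost one. *)
have dxactr r : mder K lx (xact r.+1 mY) = mder K lx (xact r mY) + 'X^r * 'X.
  by rewrite /xact iterSr mderx_xact mderM !mder_let addr0 mulr1.
have der4 a u1 u2 u3 u4 :
    der a (<< u1 >> - << u2 >> - << u3 >> + << u4 >> : alg K)
      = mder K a u1 - mder K a u2 - mder K a u3 + mder K a u4.
  exact: linext_sum4.
have der6 a u1 u2 u3 u4 u5 u6 :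
    der a (<< u1 >> - << u2 >> - << u3 >> - << u4 >> + << u5 >> + << u6 >>
             : alg K)
      = mder K a u1 - mder K a u2 - mder K a u3 - mder K a u4
        + mder K a u5 + mder K a u6.
  exact: linext_sum6.
have eval4 (u1 u2 u3 u4 : mon) :
    eval11 (<< u1 >> - << u2 >> - << u3 >> + << u4 >> : alg K) = 0.
  by rewrite eval11E [LHS]linext_sum4; ring.
move=> [[|[|p]] [[|[|q]] [r [//= _ _ []->]]]].
- split; last exact: eval4; rewrite [LHS]der4.
    by rewrite mderM !dxpow dxpow1 ?mder_let /=; ring.
  by rewrite mderM !dpow; ring.
- split.
  + rewrite [LHS]der6.
    by rewrite !mderM !mder_let /=; ring.
  + rewrite [LHS]der6.
    by rewrite !mderM !dpow !mder_let /=; ring.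
  + by rewrite eval11E [LHS]linext_sum6; ring.
- split; last exact: eval4; rewrite [LHS]der4.
    by rewrite dxact !mderM !mder_let /=; ring.
  by rewrite !(mdery_xpowY, mderM, mdery_xactY) !dpow !mder_let exprS /=; ring.
- have xpow_add : xpow (p.+2 + r) = xact r (xpow p.+2).
    by rewrite addSn addnC xpow_xact /xact iterD.
  split; last exact: eval4; rewrite [LHS]der4 xpow_add.
    (* Equating the two recursions gives [e], the only identity left once the derivative of the
       principal power cancels. *)
    have e := dxactr r; rewrite dxact in e.
    have dmulY u : mder K lx (u ** mY)%mon = 'X * mder K lx u.
      by rewrite mderM mder_let addr0.
    rewrite dxact mderx_xact !dmulY (mderx_xact _ (xpow p.+2)).
    rewrite [xpow r.+1]xpow_xact (mderx_xact r mX) mder_let /=.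
    move: (mder K lx (mX ** _)%mon) => d.
    transitivity (mder K lx (xact r mY) + 'X^r * 'X
                  - 'X * (1 + mder K lx (xact r mY))); first by ring.
    by rewrite e subrr.
  rewrite -xpow_add mdery_xact mdery_xactY addSn !mdery_xpowY exprS.
  by ring.
Qed.

(** In the product rule each term carries a factor [eval11 f] or [der a f], both zero for [f] in the
    ideal. *)
Lemma scrI_annihilated f : scrI f -> annihilated f.
Proof.
elim=> {f} [f /gens_annihilated//|||||].
- exact: annihilated0.
- move=> f g _ [fx fy f1] _ [gx gy g1].
  by split; rewrite ?derD ?eval11D ?fx ?fy ?f1 ?gx ?gy ?g1 addr0.
- move=> c f _ [fx fy f1].
  by split; rewrite ?derZ ?eval11Z ?fx ?fy ?f1 ?scaler0 ?mulr0.
- move=> g f _ [fx fy f1]; split; rewrite ?eval11_amul ?f1 ?mulr0 // der_amul.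
    by rewrite fx f1 scaler0 scale0r addr0 mulr0.
  by rewrite fy f1 scaler0 scale0r addr0 mulr0.
- move=> g f _ [fx fy f1]; split; rewrite ?eval11_amul ?f1 ?mul0r // der_amul.
    by rewrite fx f1 scaler0 scale0r addr0 mulr0.
  by rewrite fy f1 scaler0 scale0r addr0 mulr0.
Qed.

End IdealKernel.

(** * Reduction of monomials modulo the ideal *)

Section Reduction.
Variable K : fieldType.
Implicit Types (f g h : alg K) (S : set mon) (u v : mon).

(** Integer combinations only: this keeps the normal forms of monomials rational, and the inductive
    form allows reduction term by term. *)
Inductive Zspan S : alg K -> Prop :=
  | Zspan0 : Zspan S 0
  | ZspanU u of S u : Zspan S << u >>
  | ZspanD f g of Zspan S f & Zspan S g : Zspan S (f + g)
  | ZspanN f of Zspan S f : Zspan S (- f).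

Definition reducible S f := exists2 R, Zspan S R & scrI (f - R).

Lemma scrIN f : scrI f -> scrI (- f).
Proof. by move=> If; rewrite -scaleN1r; apply: Ideal_scale. Qed.

(** Congruence modulo the ideal respects products, so each factor can be reduced before
    multiplying. *)
Lemma scrI_amul f f' g g' :
  scrI (f - f') -> scrI (g - g') -> scrI (amul f g - amul f' g').
Proof.
move=> If Ig.
have -> : amul f g - amul f' g' = amul (f - f') g + amul f' (g - g').
  by rewrite amulDl amulNl amulDr amulNr addrA subrK.
by apply: Ideal_add; [apply: Ideal_mulr | apply: Ideal_mull].
Qed.

Lemma Zspan_reducible S f : Zspan S f -> reducible S f.
Proof. by exists f => //; rewrite subrr; apply: Ideal_0. Qed.

Lemma reducible_trans S f g : scrI (f - g) -> reducible S g -> reducible S f.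
Proof.
move=> Ifg [R SR IR]; exists R => //.
by rewrite -(subrK g f) -addrA; apply: Ideal_add.
Qed.

Lemma reducibleD S f g : reducible S f -> reducible S g -> reducible S (f + g).
Proof.
move=> [P SP IP] [Q SQ IQ]; exists (P + Q); first exact: ZspanD.
by rewrite opprD addrACA; apply: Ideal_add.
Qed.

Lemma reducibleN S f : reducible S f -> reducible S (- f).
Proof.
move=> [P SP IP]; exists (- P); first exact: ZspanN.
by rewrite -opprD; apply: scrIN.
Qed.

(** A four-term generator used as a rewriting rule for its first term. *)
Lemma reducible_gen4 S f g h k :
    scrI_gens (f - g - h + k) -> Zspan S g -> Zspan S h -> Zspan S k ->
  reducible S f.
Proof.
move=> If Sg Sh Sk; exists (g + (h - k)).
  by apply: ZspanD => //; apply: ZspanD => //; apply: ZspanN.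
by rewrite !opprD opprK !addrA; apply: Ideal_gen.
Qed.

Lemma reducible_gen6 S f g h k l m :
    scrI_gens (f - g - h - k + l + m) -> Zspan S g -> Zspan S h ->
    Zspan S k -> Zspan S l -> Zspan S m ->
  reducible S f.
Proof.
move=> If Sg Sh Sk Sl Sm; exists (g + (h + (k + (- l - m)))).
  do 3![apply: ZspanD => //]; apply: ZspanD; exact: ZspanN.
by rewrite !opprD !opprK !addrA; apply: Ideal_gen.
Qed.

Lemma reducible_amul S1 S2 S f g :
    (forall u v, S1 u -> S2 v -> reducible S << (u ** v)%mon >>) ->
  reducible S1 f -> reducible S2 g -> reducible S (amul f g).
Proof.
move=> red [P S1P IP] [Q S2Q IQ].
apply: reducible_trans (scrI_amul _ _ _ _ IP IQ) _.
elim: {f IP} P / S1P => [|u Su|P P' _ IH _ IH'|P _ IH].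
- by rewrite amul0l; apply/Zspan_reducible/Zspan0.
- elim: {g IQ} Q / S2Q => [|v Sv|Q Q' _ IH _ IH'|Q _ IH].
  + by rewrite amul0r; apply/Zspan_reducible/Zspan0.
  + by rewrite amulUU; apply: red.
  + by rewrite amulDr; apply: reducibleD.
  + by rewrite amulNr; apply: reducibleN.
- by rewrite amulDl; apply: reducibleD.
- by rewrite amulNl; apply: reducibleN.
Qed.

Definition xpowers : set mon := [set u | exists p, u = xpow p.+1]%classic.

Lemma scrF_xpowY p : scrF (xpow p.+1 ** mY)%mon.
Proof. by exists p; left. Qed.

Lemma scrF_xactY r : scrF (xact r mY).
Proof. by exists r; right. Qed.

Lemma mmul_xpow_reducible u v :
  xpowers u -> xpowers v -> reducible xpowers << (u ** v)%mon >>.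
Proof.
have Zx p : Zspan xpowers << xpow p.+1 >> by apply: ZspanU; exists p.
move=> [p ->] [q ->]; case: p => [|p].
  by apply: Zspan_reducible; exact: (Zx q.+1).
case: q => [|q].
  by rewrite mmultC; apply: Zspan_reducible; exact: (Zx p.+2).
apply: (@reducible_gen4 _ _ _ _ << xpow 2 >> _ (Zx p.+2) (Zx q.+2) (Zx 1%N)).
by exists p.+2, q.+2, 0%N; split=> //; apply: Or41.
Qed.

Lemma mmul_scrF_reducible u v :
  xpowers u -> scrF v -> reducible scrF << (u ** v)%mon >>.
Proof.
have Zp p : Zspan scrF << (xpow p.+1 ** mY)%mon >>.
  exact/ZspanU/scrF_xpowY.
have Zr r : Zspan scrF << xact r mY >> by exact/ZspanU/scrF_xactY.
move=> [p ->] [n [] ->].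
  (* With v = x^{q+1} y the four cases are x(xy), already in [scrF], then x^{p+2}(xy), x(x^{q+2} y)
     and x^{p+2}(x^{q+2} y), rewritten by [Fpr] with r = 1, [Frp] with r = 1 and [F_]. *)
  case: n => [|q]; case: p => [|p].
  - by apply: Zspan_reducible; exact: (Zr 2%N).
  - apply: (@reducible_gen4 _ _ _ _ _ _ (Zp p.+1) (Zr 2%N) (Zr 1%N)).
    by exists p.+2, 2%N, 1%N; split=> //; apply: Or43.
  - apply: (@reducible_gen4 _ _ _ _ _ _ (Zr 2%N) (Zp q.+2) (Zp 1%N)).
    by exists q.+2, 2%N, 1%N; split=> //; apply: Or44; rewrite /Frp addn1.
  - apply: (@reducible_gen6 _ _ _ _ _ _ _ _
             (Zr 2%N) (Zp p.+1) (Zp q.+2) (Zp 1%N) (Zr 1%N)).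
    by exists p.+2, q.+2, 0%N; split=> //; apply: Or42.
case: p => [|p].
  by apply: Zspan_reducible; exact: (Zr n.+1).
apply: (@reducible_gen4 _ _ _ _ _ _ (Zp p.+1) (Zr n.+1) (Zr 1%N)).
by exists p.+2, 2%N, n; split=> //; apply: Or43.
Qed.

Lemma xmonomial_reducible u : occ ly u = 0%N -> reducible xpowers << u >>.
Proof.
elim/mon_ind: u => [a|u v IHu IHv].
  rewrite occ_let; case: a => // _.
  by apply/Zspan_reducible/ZspanU; exists 0%N.
rewrite occM => /eqP; rewrite addn_eq0 => /andP[/eqP/IHu ru /eqP/IHv rv].
by rewrite -amulUU; apply: reducible_amul ru rv; exact: mmul_xpow_reducible.
Qed.

Lemma monomial_reducible u : occ ly u = 1%N -> reducible scrF << u >>.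
Proof.
elim/mon_ind: u => [a|u v IHu IHv].
  rewrite occ_let; case: a => // _.
  exact/Zspan_reducible/ZspanU/(scrF_xactY 0).
(* The single [y] lies in one factor, by commutativity the right one; the left factor then reduces
   to principal powers. *)
wlog yu : u v IHu IHv / occ ly u = 0%N => [hwlog|].
  rewrite occM => yuv; have [yu|yu] := eqVneq (occ ly u) 0%N.
    by apply: hwlog; rewrite ?occM.
  have yv : occ ly v = 0%N.
    by case: (occ ly u) yu yuv => [|[|k]] //= _; rewrite addSn => -[].
  by rewrite mmultC; apply: hwlog; rewrite ?occM // addnC.
rewrite occM yu => yv; rewrite -amulUU.
apply: reducible_amul (xmonomial_reducible _ yu) (IHv yv).
exact: mmul_scrF_reducible.
Qed.

End Reduction.

(** * Supports, integral coefficients and restriction to a set of monomials *)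

Section Supports.
Variables (T : choiceType) (K : fieldType) (S : T -> Prop).
Implicit Types f g : {malg K[T]}.

(** [spanF] is the instance [S := scrF]; another instance used is to contain exactly one [y]. *)
Definition supp_in f := forall u, u \in msupp f -> S u.

Lemma supp_in0 : supp_in 0.
Proof. by move=> u; rewrite msupp0 in_fset0. Qed.

Lemma supp_inU u : S u -> supp_in << u >>.
Proof. by move=> Su v /(fsubsetP msuppU_le); rewrite in_fset1 => /eqP->. Qed.

Lemma supp_inD f g : supp_in f -> supp_in g -> supp_in (f + g).
Proof.
move=> Sf Sg u /(fsubsetP (msuppD_le _ _)).
by rewrite in_fsetU => /orP[/Sf|/Sg].
Qed.

Lemma supp_inN f : supp_in f -> supp_in (- f).
Proof. by move=> Sf u; rewrite msuppN => /Sf. Qed.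

Lemma supp_inB f g : supp_in f -> supp_in g -> supp_in (f - g).
Proof. by move=> Sf Sg; apply: supp_inD => //; apply: supp_inN. Qed.

Lemma supp_inZ c f : supp_in f -> supp_in (c *: f).
Proof. by move=> Sf u /(fsubsetP (msuppZ_le _ _)) /Sf. Qed.

Lemma sum_mcoeff_delta f v :
  \sum_(u <- msupp f) f@_u * (u == v)%:R = f@_v.
Proof.
rewrite [in RHS](monalgE f) raddf_sum /=; apply: eq_bigr => u _.
by rewrite mcoeffU mulr_natr.
Qed.

(** Stronger than rational coefficients, and closed under sums without handling denominators. *)
Definition integral f := forall u, exists m : int, f@_u = m%:~R.

Lemma integral0 : integral 0.
Proof. by exists 0; rewrite mcoeff0. Qed.

Lemma integralU v : integral << v >>.
Proof. by move=> u; exists (v == u)%:Z; rewrite mcoeffU; case: eqP. Qed.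

Lemma integralD f g : integral f -> integral g -> integral (f + g).
Proof.
move=> If Ig u; have [m em] := If u; have [p ep] := Ig u.
by exists (m + p); rewrite mcoeffD em ep rmorphD.
Qed.

Lemma integralN f : integral f -> integral (- f).
Proof.
by move=> If u; have [m em] := If u; exists (- m); rewrite mcoeffN em rmorphN.
Qed.

Definition malg_part (p : pred T) f := \sum_(u <- msupp f | p u) << f@_u *g u >>.

Lemma mcoeff_part (p : pred T) f v : (malg_part p f)@_v = if p v then f@_v else 0.
Proof.
rewrite -mulrb.
rewrite /malg_part raddf_sum /= -[in RHS](sum_mcoeff_delta f) big_mkcond /=.
rewrite -sumrMnl; apply: eq_bigr => u _.
rewrite mcoeffU mulr_natr; case: eqVneq => [->|_]; first by case: (p v).
by rewrite !mulr0n mul0rn if_same.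
Qed.

End Supports.

(** * Joint injectivity of the two derivatives on the span of [scrF] *)

Section SpanF.
Variable K : fieldType.
Implicit Types (P f : alg K) (w : mon).

Lemma Zspan_spanF_rat P : Zspan K (@scrF) P -> spanF_rat P.
Proof.
move=> SP; split; first (elim: SP => {P} [|u Su|P Q _ SP _ SQ|P _ SP]).
- exact: supp_in0.
- exact: (@supp_inU mon K scrF u Su).
- exact: (@supp_inD mon K scrF P Q SP SQ).
- exact: (@supp_inN mon K scrF P SP).
have : integral mon K P.
  elim: SP => {P} [|u Su|P Q _ IP _ IQ|P _ IP].
  - exact: integral0.
  - exact: integralU.
  - exact: integralD.
  - exact: integralN.
by move=> IP u; have [m em] := IP u; exists m, 1; rewrite oner_neq0 divr1.
Qed.

Lemma coef_der a P k :
  (der a P)`_k = \sum_(u <- msupp P) P@_u * (mder K a u)`_k.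
Proof. by rewrite /der coef_sum; apply: eq_bigr => u _; rewrite coefZ. Qed.

Lemma coef_dery_spanF P k : spanF P -> (1 < k)%N ->
  (der ly P)`_k = P@_(xact k mY).
Proof.
move=> FP lt1k; rewrite coef_der -[RHS]sum_mcoeff_delta.
by apply: eq_big_seq => u /FP Fu; rewrite (coef_mdery_scrF _ _ _ Fu lt1k).
Qed.

Lemma coef_derx_spanF P k : spanF P -> (1 < k)%N ->
    (forall u, u \in msupp P -> (occ lx u <= k)%N) ->
  (der lx P)`_k = P@_(xpow k ** mY)%mon *+ 2 + P@_(xact k mY).
Proof.
move=> FP lt1k lek; rewrite coef_der.
rewrite -(sum_mcoeff_delta _ _ P (xact k mY)).
rewrite -(sum_mcoeff_delta _ _ P (xpow k ** mY)%mon) -sumrMnl -big_split /=.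
apply: eq_big_seq => u uP.
rewrite (coef_mderx_scrF _ _ _ (FP _ uP) lt1k (lek _ uP)) mulrDr.
by congr (_ + _); exact: mulrnAr.
Qed.

Hypothesis char_neq2 : 2%:R != 0 :> K.

(** In top degree k > m, the coefficient of t^k in [der ly P] is that of x^{k} y; once it is zero,
    the one in [der lx P] is twice that of x^k y. Both vanish, and this is where 2 must be
    invertible. *)
Lemma spanF_occ_le P m : spanF P -> (0 < m)%N ->
    (size (der lx P) <= m.+1)%N -> (size (der ly P) <= m.+1)%N ->
  forall u, u \in msupp P -> (occ lx u <= m)%N.
Proof.
move=> FP m_gt0 sx sy.
(* Descent: start from the trivial bound with k the x-degree of [P], and lower it by one at each
   step. *)
suff step k : (forall u, u \in msupp P -> (occ lx u <= m + k)%N) ->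
    forall u, u \in msupp P -> (occ lx u <= m)%N.
  move=> u uP; apply: (step (deg_ lx P)) u uP => u uP.
  by apply: leq_trans (leq_addl _ _); apply: leq_bigmax_seq.
elim: k => [|k IH] lek; first by move=> u /lek; rewrite addn0.
apply: IH => u uP; have lt1 : (1 < m + k.+1)%N by lia.
have sz a : (size (der a P) <= m.+1)%N -> (der a P)`_(m + k.+1) = 0.
  by move=> sa; rewrite nth_default // (leq_trans sa) // addnS ltnS leq_addr.
have eb : P@_(xact (m + k.+1) mY) = 0 by rewrite -coef_dery_spanF // sz.
have ea : P@_(xpow (m + k.+1) ** mY)%mon = 0.
  have := coef_derx_spanF _ _ FP lt1 lek.
  rewrite eb addr0 sz // => /esym/eqP.
  by rewrite -mulr_natr mulf_eq0 (negPf char_neq2) orbF => /eqP.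
rewrite -ltnS -addnS ltn_neqAle lek // andbT; apply/eqP => eu.
have : P@_u != 0 by rewrite mcoeff_neq0.
have [n [] un] := FP _ uP; move: eu; rewrite un.
  rewrite occM occ_xpow occ_let muln1 addn0 => ->.
  by rewrite ea eqxx.
rewrite occ_xact occ_let muln1 addn0 => ->.
by rewrite eb eqxx.
Qed.

(** Taking m = 1 in [spanF_occ_le] leaves only y and x y, both of the form x^{k} y, and [der ly]
    separates these. *)
Lemma spanF_eq0 P : spanF P -> der lx P = 0 -> der ly P = 0 -> P = 0.
Proof.
move=> FP dx dy.
have uE u : u \in msupp P -> exists k, u = xact k mY.
  move=> uP; have [n [] un] := FP _ uP; last by exists n.
  have : (occ lx u <= 1)%N.
    by apply: (spanF_occ_le P 1) uP; rewrite ?dx ?dy ?size_poly0.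
  rewrite un occM occ_xpow occ_let muln1 addn0.
  by case: n {un} => // _; exists 1%N.
apply/malgP => u; rewrite mcoeff0; apply: contrapT => /eqP.
rewrite mcoeff_neq0 => uP; have [k uk] := uE _ uP.
suff : P@_u = 0 by move/eqP; rewrite mcoeff_eq0 uP.
rewrite uk -(sum_mcoeff_delta _ _ P (xact k mY)).
transitivity ((der ly P)`_k); last by rewrite dy coef0.
rewrite coef_der; apply: eq_big_seq => v /uE [j ->]; congr (_ * _).
by rewrite coef_mdery_xact.
Qed.

End SpanF.

(** * Monomials of maximal depth *)

Section Caterpillars.
Variable K : fieldType.
Implicit Types (a : letter) (u v w : mon).

Lemma single_leafP u : (occ lx u + occ ly u = 1)%N -> exists a, u = mlet a.
Proof.
elim/mon_ind: u => [a|u v _ _]; first by exists a.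
rewrite !occM; have := occ_gt0 u; have := occ_gt0 v; lia.
Qed.

Lemma xpow_of_size_mder a u : occ ly u = 0%N ->
  (occ lx u <= size (mder K a u))%N -> exists p, u = xpow p.+1.
Proof.
elim/mon_ind: u => [b|u v IHu IHv].
  by rewrite occ_let; case: b => // _ _; exists 0%N.
wlog uv : u v IHu IHv / (size (mder K a u) <= size (mder K a v))%N => [hwlog|].
  have [uv|/ltnW vu] := leqP (size (mder K a u)) (size (mder K a v)).
    exact: hwlog.
  by rewrite mmultC; apply: hwlog.
rewrite !occM => yuv le_uv; have := size_mderM K a u v.
rewrite (maxn_idPr uv) => le_v.
have := size_mder K a v; have := occ_gt0 u => u_gt0 sv.
(* The product adds only 1 to the size of [v], so the hypothesis leaves one letter for [u] and makes
   [v] extremal too. *)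
have [p vp] : exists p, v = xpow p.+1 by apply: IHv; lia.
have [b ub] : exists b, u = mlet b by apply: single_leafP; lia.
exists p.+1; rewrite vp ub xpowS; congr mmult.
by move: yuv; rewrite ub occ_let; case: b {ub}.
Qed.

Lemma caterpillar_of_size_mder a w : occ ly w = 1%N ->
    (occ lx w < size (mder K a w))%N ->
  w = mY \/ exists r p, w = xact r (xpow p.+1 ** mY)%mon.
Proof.
elim/mon_ind: w => [b|u v IHu IHv].
  by rewrite occ_let; case: b => // _ _; left.
wlog yu : u v IHu IHv / occ ly u = 0%N => [hwlog|].
  rewrite occM => yuv; have [yu|yu] := eqVneq (occ ly u) 0%N.
    by apply: hwlog; rewrite ?occM.
  rewrite mmultC; apply: hwlog; rewrite ?occM //; lia.
rewrite !occM yu => yv lt_uv; right.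
have s_uv := leq_trans lt_uv (size_mderM K a u v).
have su := size_mder K a u; have sv := size_mder K a v.
have u_gt0 := occ_gt0 u.
(* The factor with the larger derivative is extremal and the other is one letter: [y] if [u] is the
   larger, [x] otherwise. *)
have [vu|/ltnW uv] := leqP (size (mder K a v)) (size (mder K a u)).
  rewrite (maxn_idPl vu) in s_uv.
  have [p up] : exists p, u = xpow p.+1.
    by apply: (xpow_of_size_mder a) => //; lia.
  have [b vb] : exists b, v = mlet b by apply: single_leafP; lia.
  exists 0%N, p; rewrite up vb; congr mmult.
  by move: yv; rewrite vb occ_let; case: b {vb}.
rewrite (maxn_idPr uv) in s_uv.
have [b ub] : exists b, u = mlet b by apply: single_leafP; lia.
have {ub} uX : u = mX by move: yu; rewrite ub occ_let; case: b {ub}.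
have [||->|[r [p ->]]] := IHv; [lia | lia | |]; rewrite uX.
  by exists 0%N, 0%N.
by exists r.+1, p.
Qed.

(** The caterpillars x^{r}(x^{p+1} y) with r = 0 or p = 0 lie in [scrF]; the others are the
    exceptional monomials. *)
Lemma exceptional_of_size_mder a w : occ ly w = 1%N -> ~ scrF w ->
  (occ lx w < size (mder K a w))%N -> exceptional w.
Proof.
move=> yw Fw sw; have [wY|[r [p wE]]] := caterpillar_of_size_mder a w yw sw.
  by case: Fw; rewrite wY; exact: (scrF_xactY 0).
case: r wE => [|r] wE; first by case: Fw; rewrite wE; exact: scrF_xpowY.
case: p wE => [|p] wE; last by exists r.+1, p.+2.
case: Fw; rewrite wE (_ : xact _ _ = xact r.+2 mY); first exact: scrF_xactY.
by rewrite [RHS]/xact iterSr.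
Qed.

End Caterpillars.

(** * Train decomposition, uniqueness of normal forms and the polynomials P_w *)

Lemma bigmax_attained (T : eqType) (F : T -> nat) (s : seq T) :
  s != [::] -> exists x, x \in s /\ F x = \max_(y <- s) F y.
Proof.
elim: s => // x s IH _; rewrite big_cons.
have [->|/IH [y [ys yE]]] := eqVneq s [::].
  by exists x; rewrite inE eqxx big_nil maxn0.
have [le|/ltnW le] := leqP (\max_(z <- s) F z) (F x).
  by exists x; rewrite inE eqxx.
by exists y; rewrite inE ys orbT.
Qed.

Section Assembly.
Variable K : fieldType.
Implicit Types (P Q R f : alg K) (w : mon).

Lemma pi_IP f R : pi_I f = pi_I R <-> scrI (f - R).
Proof.
split=> [e|IfR].
  have : pi_I f R by rewrite e /pi_I /= subrr; exact: Ideal_0.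
  by rewrite /pi_I /= => IRf; rewrite -opprB; apply: scrIN.
apply/seteqP; split=> g; rewrite /pi_I /= => Ig.
  by rewrite -(subrK f g) -addrA; apply: Ideal_add.
rewrite -(subrK R g) -addrA; apply: Ideal_add => //.
by rewrite -opprB; apply: scrIN.
Qed.

Lemma train_polyP f : (forall u, u \in msupp f -> occ ly u = 1%N) ->
  ~ homogeneous f -> eval11 f = 0 -> exists n, train_poly n f.
Proof.
move=> yf nhom f1.
pose n := deg_ lx f; exists n; split=> //.
pose part (k : nat) : alg K := malg_part mon K (fun u => occ lx u == k) f.
have partE k u : (part k)@_u = if occ lx u == k then f@_u else 0.
  exact: mcoeff_part.
have part_type k : homog_type (k, 1%N) (part k).
  move=> u; rewrite -mcoeff_neq0 partE.
  have [xu|_] := eqVneq (occ lx u) k; last by rewrite eqxx.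
  by rewrite mcoeff_neq0 /mtype => /yf ->; rewrite xu.
have le_n u : u \in msupp f -> (occ lx u <= n)%N.
  by move=> uf; apply: leq_bigmax_seq.
(* All degrees below n are listed, even those with zero component, since 0 satisfies every
   [homog_type]; the sign offsets the subtraction in [train_poly]. *)
exists (part n), n, (fun i => i : nat), (fun i : 'I_n => - part i).
split=> //.
- apply/malgP => u; rewrite sumrN opprK mcoeffD partE raddf_sum /=.
  under eq_bigr => i _ do rewrite partE.
  have [uf|uf] := boolP (u \in msupp f); last first.
    rewrite mcoeff_outdom // if_same add0r big1 // => i _.
    by rewrite if_same.
  have := le_n _ uf; rewrite leq_eqVlt => /orP[/eqP xu|ltu].
    rewrite xu eqxx big1 ?addr0 // => i _.
    by rewrite gtn_eqF.
  rewrite ltn_eqF // add0r (bigD1 (Ordinal ltu)) //= eqxx.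
  rewrite big1 ?addr0 // => i; rewrite -val_eqE /= eq_sym.
  by move=> /negPf ->.
- split; last exact: part_type.
  (* As 0 is homogeneous, [f] is nonzero, so some monomial of its support attains the degree n. *)
  have [/eqP f0|/fset0Pn [u0 u0f]] := boolP (msupp f == fset0).
    by case: nhom; exists (0%N, 0%N) => u; rewrite f0 in_fset0.
  have [v [vf xv]] : exists v, v \in msupp f /\ occ lx v = n.
    by apply: bigmax_attained; apply: contraTneq u0f => e;
    rewrite -[_ \in _]/(u0 \in enum_fset (msupp f)) e.
  move=> /malgP/(_ v); rewrite partE xv eqxx mcoeff0 => /eqP.
  by rewrite mcoeff_eq0 vf.
- by move=> i u; rewrite msuppN; apply: part_type.
Qed.

(** Reductions of monomials are combined with the coefficients of [f], which are arbitrary in [K];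
    hence [spanF] rather than [spanF_rat]. *)
Lemma exists_is_pi f : (forall u, u \in msupp f -> occ ly u = 1%N) ->
  exists R, is_pi f R.
Proof.
move=> yf; suff [R FR IR] : exists2 R, spanF R & scrI (f - R).
  by exists R; split=> //; apply/pi_IP.
rewrite (monalgE f) big_seq.
apply: (big_ind (fun g => exists2 R, spanF R & scrI (g - R))).
- by exists 0; [exact: supp_in0 | rewrite subr0; exact: Ideal_0].
- move=> g h [P FP IP] [Q FQ IQ]; exists (P + Q).
    exact: (supp_inD mon K scrF P Q FP FQ).
  by rewrite opprD addrACA; apply: Ideal_add.
move=> u /yf/(monomial_reducible K) [P ZP IP]; exists (f@_u *: P).
  exact: (supp_inZ mon K scrF _ P (Zspan_spanF_rat _ _ ZP).1).
have -> : << f@_u *g u >> = f@_u *: << u >> :> alg K.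
  by rewrite scale_malgU mulr1.
rewrite -scalerBr.
exact: Ideal_scale.
Qed.

Hypothesis char_neq2 : 2%:R != 0 :> K.

Lemma spanF_scrI_eq P Q : spanF P -> spanF Q -> scrI (P - Q) -> P = Q.
Proof.
move=> FP FQ /scrI_annihilated [dx dy _]; apply/eqP; rewrite -subr_eq0.
apply/eqP/(spanF_eq0 K char_neq2) => //.
exact: (supp_inB mon K scrF P Q FP FQ).
Qed.

Lemma is_pi_unique f : (forall u, u \in msupp f -> occ ly u = 1%N) ->
  exists! R, is_pi f R.
Proof.
move=> yf; have [R piR] := exists_is_pi f yf; exists R; split=> // Q [FQ pifQ].
case: piR => FR pifR; apply: spanF_scrI_eq => //.
by apply/pi_IP; rewrite -pifR pifQ.
Qed.

Lemma is_pi_evanescent f R : is_pi f R -> f - R <> 0 -> evanescent (f - R).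
Proof. by move=> [_ /pi_IP/scrI_annihilated[dx dy f1]] f0. Qed.

Lemma is_pi_evanescent_train f R :
    (forall u, u \in msupp f -> occ ly u = 1%N) -> is_pi f R ->
  ~ homogeneous (f - R) -> evanescent_train (f - R).
Proof.
move=> yf piR nhom; have ev : evanescent (f - R).
  apply: is_pi_evanescent => // f0; apply: nhom; exists (0%N, 0%N) => u.
  by rewrite f0 msupp0 in_fset0.
split=> //; apply: train_polyP nhom _; last by case: ev.
apply: (supp_inB mon K (fun u => occ ly u = 1%N) f R yf) => u uR.
by apply: occ_scrF; apply: piR.1.
Qed.

Lemma is_pi_sub_not_homogeneous n w R : (3 <= n)%N -> mtype w = (n, 1%N) ->
    ~ scrF w -> is_pi << w >> R ->
    (~ exceptional w -> forall u, u \in msupp R -> (occ lx u < n)%N) ->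
  ~ homogeneous (<< w >> - R).
Proof.
move=> le3n tw Fw [FR /pi_IP/scrI_annihilated[dx dy f1]] degR [t homt].
have coefB u : (<< w >> - R : alg K)@_u = (w == u)%:R - R@_u.
  by rewrite mcoeffB mcoeffU.
have Rw : R@_w = 0.
  by apply: mcoeff_outdom; apply/negP => /FR.
(* Since [w] is outside [scrF], no term of [R] cancels it, and its type is the common one. *)
have tn : t = (n, 1%N).
  rewrite -tw; apply/esym/homt.
  by rewrite -mcoeff_neq0 coefB Rw eqxx subr0 oner_neq0.
have xR u : u \in msupp R -> occ lx u = n.
  move=> uR; suff /homt : u \in msupp (<< w >> - R) by rewrite tn => -[].
  rewrite -mcoeff_neq0 coefB; have [wu|_] := eqVneq w u.
    by case: Fw; rewrite wu; apply: FR.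
  by rewrite sub0r oppr_eq0 mcoeff_neq0.
have [ew|/degR ltn_R] := pselect (exceptional w); last first.
  have R0 : R = 0.
    apply/malgP => u; rewrite mcoeff0; apply: mcoeff_outdom; apply/negP => uR.
    by have := ltn_R _ uR; rewrite xR // ltnn.
  (* With [R] zero, the coefficient sum would be that of [w] alone, namely 1. *)
  by move/eqP: f1; rewrite R0 subr0 eval11_mon oner_eq0.
have [r [p [r_gt0 p_gt1 wE]]] := ew.
have np : n = (r + p)%N.
  case: p p_gt1 {ew} wE => // p _ wE; case: tw => <- _.
  by rewrite wE occ_xact occM occ_xpow occ_let !muln1 addn0.
(* For w = x^{r}(x^p y) the leaf [y] has depth r + 1, which forces x^{r+1} y into [R]; its degree r
   + 1 is below n = r + p. *)
have : (der ly R)`_r.+1 = 1.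
  move/eqP: dy; rewrite derB subr_eq0 der_mon => /eqP <-.
  rewrite wE mdery_xact; case: p p_gt1 {ew wE np} => // p _.
  by rewrite mdery_xpowY -exprSr coefXn eqxx.
rewrite (coef_dery_spanF K R r.+1 FR) ?ltnS // => R1.
have /xR : xact r.+1 mY \in msupp R by rewrite -mcoeff_neq0 R1 oner_neq0.
by rewrite occ_xact occ_let muln1 addn0; lia.
Qed.

(** [R] and [w] have the same derivatives, so the depth of [w] bounds the degree of [R]; depth n is
    reached only by caterpillars. *)
Lemma is_pi_occ_le n w R : (3 <= n)%N -> mtype w = (n, 1%N) -> ~ scrF w ->
    is_pi << w >> R ->
  (forall u, u \in msupp R -> (occ lx u <= n)%N) /\
  (~ exceptional w -> forall u, u \in msupp R -> (occ lx u < n)%N).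
Proof.
move=> le3n [xw yw] Fw [FR /pi_IP/scrI_annihilated[dx dy _]].
have dR a : der a (<< w >> - R) = 0 -> der a R = mder K a w.
  by move=> /eqP; rewrite derB subr_eq0 der_mon => /eqP.
have dRx := dR _ dx; have dRy := dR _ dy; split.
  apply: (spanF_occ_le K char_neq2) => //; first by lia.
    by rewrite dRx (leq_trans (size_mder _ _ _)) // xw yw addn1.
  by rewrite dRy (leq_trans (size_mder _ _ _)) // xw yw addn1.
move=> new.
have sz a : (size (mder K a w) <= n.-1.+1)%N.
  rewrite (ltn_predK le3n) leqNgt; apply/negP => lt_s; apply: new.
  by apply: (exceptional_of_size_mder K a) => //; rewrite xw.
have n1_gt0 : (0 < n.-1)%N by rewrite -ltnS (ltn_predK le3n) ltnW.
move=> u uR; rewrite -(ltn_predK le3n) ltnS.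
by apply: (spanF_occ_le K char_neq2) uR => //; rewrite ?dRx ?dRy.
Qed.

Lemma deg_le a f m : (forall u, u \in msupp f -> (occ a u <= m)%N) ->
  (deg_ a f <= m)%N.
Proof. by move=> le_m; apply/bigmax_leqP_seq => u /le_m. Qed.

Lemma is_pi_is_P n w R : (3 <= n)%N -> mtype w = (n, 1%N) -> ~ scrF w ->
  is_pi << w >> R -> spanF_rat R -> is_P n w R.
Proof.
move=> le3n tw Fw piR QR; have [le_n lt_n] := is_pi_occ_le _ _ _ le3n tw Fw piR.
split=> //; first exact: deg_le.
  move=> /lt_n ltR; rewrite -(ltn_predK le3n) ltnS; apply: deg_le => u /ltR.
  by rewrite -{1}(ltn_predK le3n) ltnS.
apply: (is_pi_evanescent_train _ _ _ piR).
  move=> u /(fsubsetP msuppU_le); rewrite in_fset1 => /eqP ->.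
  by case: tw.
exact: is_pi_sub_not_homogeneous tw Fw piR lt_n.
Qed.

(** Evanescence of w - P does not by itself put it in the ideal; [P] is compared with the reduction
    of [w], which has the same derivatives and so equals [P]. *)
Lemma is_P_is_pi n w P : mtype w = (n, 1%N) -> is_P n w P -> is_pi << w >> P.
Proof.
move=> [_ yw] [[FP _] _ _ [[_ dx dy _] _]].
have [R ZR IR] := monomial_reducible K w yw.
have FR := (Zspan_spanF_rat _ _ ZR).1.
have [ex ey _] := scrI_annihilated _ _ IR.
suff -> : P = R by split=> //; apply/pi_IP.
apply/eqP; rewrite -subr_eq0; apply/eqP/(spanF_eq0 K char_neq2).
- exact: (supp_inB mon K scrF P R FP FR).
- move/eqP: dx; move/eqP: ex; rewrite !derB !subr_eq0 => /eqP -> /eqP ->.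
  by rewrite subrr.
- move/eqP: dy; move/eqP: ey; rewrite !derB !subr_eq0 => /eqP -> /eqP ->.
  by rewrite subrr.
Qed.

End Assembly.

Theorem mainTheorem5 (K : fieldType) (char_neq2 : 2%:R != 0 :> K) :
  (forall (n : nat) (w : mon), (3 <= n)%N -> mtype w = (n, 1%N) -> ~ scrF w ->
     card_units_gt K (maxn (occ lx w) (occ ly w)) ->
     (exists! P : alg K, is_P n w P) /\
     (forall P : alg K, is_P n w P -> is_pi << w >> P))
  /\
  (forall f : alg K, in_sum3 f ->
     card_units_gt K (maxn (deg_ lx f) (deg_ ly f)) ->
     (exists! R : alg K, is_pi f R) /\
     (forall R : alg K, is_pi f R ->
        (~ spanF f -> evanescent (f - R)) /\
        (~ homogeneous (f - R) -> evanescent_train (f - R)))).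
Proof.
split=> [n w le3n tw Fw _|f f3 _].
  have PpiP (P : alg K) : is_P n w P -> is_pi << w >> P.
    exact: (is_P_is_pi K char_neq2 n).
  split=> //; have yw : occ ly w = 1%N by case: tw.
  have [R ZR IR] := monomial_reducible K w yw.
  have QR := Zspan_spanF_rat _ _ ZR.
  have piR : is_pi << w >> R by split; [case: QR | apply/pi_IP].
  (* The witness is the reduction of [w]; any other candidate represents the same class, so it
     equals [R]. *)
  exists R; split; first exact: is_pi_is_P.
  move=> P /PpiP [FP piP]; apply: (spanF_scrI_eq K char_neq2) => //.
    by case: QR.
  by apply/pi_IP; rewrite -piR.2 piP.
have yf u : u \in msupp f -> occ ly u = 1%N.
  by move=> /f3 [m _ []].
split; first exact: is_pi_unique.
move=> R piR; split; last exact: is_pi_evanescent_train.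
move=> Ff; apply: is_pi_evanescent => // /eqP; rewrite subr_eq0 => /eqP e.
by apply: Ff; rewrite e; case: piR.
Qed.
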